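(* For each pair $(n,k)$ with (1) $n=4$ and $k\in\{4,6,8,10\}$, or (2) $n=5$ and $k\in\{4,16,18,20,22,24,26\}$, or (3) $n=6$ and $k=54$, or (4) $n=7$ and $k=114$, there exists a $k$-regular closed XOR-magic graph of power $n$.
   Context: All graphs are simple; a graph is $k$-regular if every vertex has exactly $k$ neighbours. For a vertex $x$, $N[x]$ is the set consisting of $x$ and its neighbours. A simple connected graph $G=(V,E)$ with $|V|=2^n$ is a closed XOR-magic graph of power $n$ if there is a bijection $\ell:V\to(\mathbb{Z}_2)^n$ such that $\sum_{y\in N[x]}\ell(y)$ is the zero vector of $(\mathbb{Z}_2)^n$ for every $x\in V$. *)

(* Defs.v *)
From mathcomp Require Import all_boot all_algebra.

Set Implicit Arguments.
Unset Strict Implicit.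
Unset Printing Implicit Defensive.

Local Open Scope ring_scope.

Section XorMagic.

Variable V : finType.
Implicit Type e : rel V.

Definition simple_graph e : Prop := symmetric e /\ irreflexive e.

Definition connected_graph e : Prop := forall x y : V, connect e x y.

Definition neighbours e (x : V) : {set V} := [set y | e x y].

Definition closed_neighbourhood e (x : V) : {set V} := x |: neighbours e x.

Definition regular_graph (k : nat) e : Prop :=
  forall x : V, #|neighbours e x| = k.

Definition closed_xor_magic (n : nat) e : Prop :=
  [/\ simple_graph e,
      connected_graph e,
      #|V| = (2 ^ n)%N &
      exists l : V -> 'rV['F_2]_n,
        bijective l /\
        forall x : V, \sum_(y in closed_neighbourhood e x) l y = 0].

End XorMagic.

(* Main.v *)
Require Import Defs.
From Stdlib Require Import PeanoNat.
From mathcomp Require Import all_boot all_algebra.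

Set Implicit Arguments.
Unset Strict Implicit.
Unset Printing Implicit Defensive.

Import GRing.Theory.

(** Let the vertices be the labels themselves, [x : 'rV['F_2]_n], and describe
    a graph by the set [S x] of directions in which the edges leave [x].
    Suppose every [S x] has [d] elements whose sum is [x].  The neighbours
    [x + v] of [x] then sum to [d x + x].  If [d] is even, adding the label [x]
    gives zero.  If [d] is odd, the neighbours already sum to zero, hence so
    does their complement, which is the closed neighbourhood of [x] in the
    complementary graph: that graph is regular of degree [2 ^ n - 1 - d], and
    connected when [2 d < 2 ^ n].

    Such systems extend: if [N_1 + ... + N_r] is the identity of [F_2 ^ m],
    every [N_i] has square zero, and [p_1, ..., p_r] are distinct nonzero
    vectors of sum zero that no [S y] uses, then the directions [(0, v)], for
    [v] in [S y], and [(x N_i, p_i)] at the vertex [(x, y)] have sum [(x, y)],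
    and moving along one of them does not change it.  With [m = 0] this adjoins
    [r] fixed directions; with [m = 2] and the three nilpotent matrices of rank
    one, whose sum is the identity, it raises the power by two.  Five small
    tables and such extensions reach every pair [(n, k)]. *)

Section ComplementGraph.

Variables (V : finType) (e : rel V).

Definition complement_graph : rel V := fun x y => (x != y) && ~~ e x y.

Lemma neighbours_complement x :
  neighbours complement_graph x = ~: closed_neighbourhood e x.
Proof. by apply/setP=> y; rewrite !inE negb_or eq_sym. Qed.

Hypothesis simple_e : simple_graph e.

Lemma complement_simple : simple_graph complement_graph.
Proof.
have [sym_e _] := simple_e.
by split=> [x y|x]; rewrite /complement_graph ?eqxx // eq_sym sym_e.
Qed.

Lemma closed_neighbourhood_complement x :
  closed_neighbourhood complement_graph x = ~: neighbours e x.
Proof.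
have [_ irr_e] := simple_e.
apply/setP=> y; rewrite !inE eq_sym /complement_graph.
by case: eqP => // <-; rewrite irr_e.
Qed.

Lemma sum_closed_complement (W : zmodType) (l : V -> W) x :
  (\sum_y l y = 0 -> \sum_(y in neighbours e x) l y = 0 ->
   \sum_(y in closed_neighbourhood complement_graph x) l y = 0)%R.
Proof.
rewrite (bigID (mem (neighbours e x))) /= => sumV sumN.
rewrite closed_neighbourhood_complement -[RHS]sumV sumN add0r.
by apply: eq_bigl => y; rewrite inE.
Qed.

Variable k : nat.
Hypothesis regular_e : regular_graph k e.

Lemma card_closed_neighbourhood x : #|closed_neighbourhood e x| = k.+1.
Proof. by have [_ irr_e] := simple_e; rewrite cardsU1 regular_e inE irr_e. Qed.

Lemma complement_regular : regular_graph (#|V| - k.+1) complement_graph.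
Proof.
move=> x; rewrite neighbours_complement cardsCs setCK.
by rewrite card_closed_neighbourhood.
Qed.

Lemma complement_connected : k.*2 < #|V| -> connected_graph complement_graph.
Proof.
move=> k_lt x y; have [sym_e _] := simple_e; have [csym _] := complement_simple.
have [->|xy] := eqVneq x y; first exact: connect0.
have [cxy|] := boolP (complement_graph x y); first exact: connect1.
rewrite /complement_graph xy /= negbK => exy.
(* [B x] and [B y] both contain [x] and [y], so they do not cover [V]. *)
pose B := closed_neighbourhood e.
have common2 : 2 <= #|B x :&: B y|.
  suff /subset_leq_card : [set x; y] \subset B x :&: B y by rewrite cards2 xy.
  by rewrite subUset !sub1set !inE !eqxx exy sym_e exy !orbT.
have /subsetPn[z _] : ~~ ([set: V] \subset B x :|: B y).
  apply: contraL k_lt => /subset_leq_card; rewrite cardsT -leqNgt.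
  move=> /leq_trans-> //; rewrite cardsU !card_closed_neighbourhood addnn.
  by rewrite leq_subLR doubleS -add2n leq_add2r.
rewrite inE negb_or -!in_setC -!neighbours_complement !inE => /andP[xz yz].
by apply: connect_trans (connect1 xz) (connect1 _); rewrite csym.
Qed.

End ComplementGraph.

Definition odd_complement_degree (n d k : nat) : bool :=
  [&& odd d, 1 < n, d.*2 < 2 ^ n & k == 2 ^ n - d.+1].

Definition has_regular_xor_magic (n k : nat) : Prop :=
  exists (V : finType) (e : rel V), closed_xor_magic n e /\ regular_graph k e.

Section DirectionSystems.

Local Open Scope ring_scope.

Lemma sum_all_rows (R : finNzRingType) n :
  (1 < n)%N -> \sum_(x : 'rV[R]_n) x = 0.
Proof.
move=> n_gt1; apply/rowP=> i; rewrite mxE.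
have [j ji] : exists j : 'I_n, j != i.
  exists (if val i == 0%N then Ordinal n_gt1 else Ordinal (ltnW n_gt1)).
  by case: ifP => [/eqP i0|/negbT i0]; rewrite -val_eqE /= ?i0 // eq_sym.
(* The transvections [x |-> x + x_i e_j] permute the vectors. *)
pose f (x : 'rV[R]_n) : 'rV[R]_n := x + x 0 i *: delta_mx 0 j.
have f_inj : injective f.
  move=> x y fxy; have := congr1 (fun z : 'rV_n => z 0 i) fxy.
  rewrite !mxE eqxx eq_sym (negPf ji) !mulr0 !addr0 => xyi.
  by move: fxy; rewrite /f xyi => /addIr.
have : \sum_x f x = \sum_x x by rewrite [RHS](reindex_inj f_inj).
rewrite big_split /= -scaler_suml -[RHS]addr0 => /addrI/rowP/(_ j).
by rewrite !mxE !eqxx mulr1 summxE.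
Qed.

Lemma addvv_F2 (V : lmodType 'F_2) (x : V) : x + x = 0.
Proof. by rewrite -mulr2n -scaler_nat pchar_Fp_0 ?scale0r. Qed.

Lemma addKv_F2 (V : lmodType 'F_2) (x : V) : involutive (+%R x).
Proof. by move=> y; rewrite addrA addvv_F2 add0r. Qed.

Lemma mulrn_F2 (V : lmodType 'F_2) (x : V) m : x *+ m = x *+ odd m.
Proof.
elim: m => // m IHm; rewrite mulrS IHm /=.
by case: odd; rewrite ?addvv_F2 ?addr0.
Qed.

Definition direction_assignment n : Type := 'rV['F_2]_n -> {set 'rV['F_2]_n}.

Record direction_system n d (S : direction_assignment n) : Prop :=
  DirectionSystem {
    direction_shift : forall x v, v \in S x -> v \in S (x + v);
    direction_neq0 : forall x, 0 \notin S x;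
    card_directions : forall x, #|S x| = d;
    sum_directions : forall x, \sum_(v in S x) v = x }.

Definition direction_graph n (S : direction_assignment n) : rel 'rV['F_2]_n :=
  fun x y => x + y \in S x.

Lemma card_rV_F2 n : #|{: 'rV['F_2]_n}| = (2 ^ n)%N.
Proof. by rewrite card_mx card_Fp ?mul1n. Qed.

Section DirectionGraph.

Variables (n d : nat) (S : direction_assignment n).
Hypothesis sysS : direction_system d S.

Lemma neighbours_direction_graph x :
  neighbours (direction_graph S) x = [set x + v | v in S x].
Proof.
apply/setP=> y; rewrite inE; apply/idP/imsetP => [xy|[v vS ->]].
  by exists (x + y); rewrite ?addKv_F2.
by rewrite /direction_graph addKv_F2.
Qed.

Lemma direction_graph_regular : regular_graph d (direction_graph S).
Proof.
move=> x; rewrite neighbours_direction_graph card_imset; last exact: addrI.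
exact: card_directions sysS x.
Qed.

Lemma sum_neighbours_direction_graph x :
  \sum_(y in neighbours (direction_graph S) x) y = x *+ d.+1.
Proof.
rewrite neighbours_direction_graph big_imset /=; last first.
  by move=> u v _ _; apply: addrI.
rewrite big_split /= sumr_const (card_directions sysS).
by rewrite (sum_directions sysS) -mulrSr.
Qed.

Lemma direction_graph_simple : simple_graph (direction_graph S).
Proof.
split=> [x y|x]; last first.
  by apply/negbTE; rewrite /direction_graph addvv_F2 (direction_neq0 sysS).
rewrite /direction_graph [y + x]addrC.
apply/idP/idP=> /(direction_shift sysS); first by rewrite addKv_F2.
by rewrite [x + y]addrC addKv_F2.
Qed.

Lemma even_direction_system :
  ~~ odd d -> connected_graph (direction_graph S) -> has_regular_xor_magic n d.
Proof.
move=> d_even conn; exists 'rV['F_2]_n, (direction_graph S).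
have simple := direction_graph_simple; have [_ irr] := simple.
split; last exact: direction_graph_regular.
split=> //; first exact: card_rV_F2.
exists id; split=> [|x]; first by exists id.
rewrite big_setU1 ?inE ?irr //= sum_neighbours_direction_graph.
by rewrite mulrn_F2 /= d_even addvv_F2.
Qed.

Lemma odd_direction_system k :
  odd_complement_degree n d k -> has_regular_xor_magic n k.
Proof.
case/and4P=> d_odd n_gt1; rewrite -card_rV_F2 => d_lt /eqP->.
have [simple regular] := (direction_graph_simple, direction_graph_regular).
exists 'rV['F_2]_n, (complement_graph (direction_graph S)).
split; last exact: complement_regular.
split; [exact: complement_simple | exact: complement_connected d_lt | | ].
  exact: card_rV_F2.
exists id; split=> [|x]; first by exists id.
apply: sum_closed_complement => //; first exact: sum_all_rows.
by rewrite sum_neighbours_direction_graph mulrn_F2 /= d_odd.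
Qed.

End DirectionGraph.

Lemma sum_row_mx (R : nzRingType) m n J (r : seq J) (P : pred J)
    (f : J -> 'rV[R]_m) (g : J -> 'rV[R]_n) :
  \sum_(j <- r | P j) row_mx (f j) (g j)
    = row_mx (\sum_(j <- r | P j) f j) (\sum_(j <- r | P j) g j).
Proof.
rewrite -[LHS]hsubmxK !linear_sum.
by congr row_mx; apply: eq_bigr => j _ /=; rewrite ?row_mxKl ?row_mxKr.
Qed.

Definition square_zero_partition m (I : finType) (N : I -> 'M['F_2]_m) : Prop :=
  (forall i, N i *m N i = 0) /\ \sum_i N i = 1%:M.

Section Extension.

Variables (m n d : nat) (S : direction_assignment n).
Variables (I : finType) (N : I -> 'M['F_2]_m) (p : I -> 'rV['F_2]_n).

Definition kept_directions : direction_assignment (m + n) :=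
  fun x => [set row_mx 0 v | v in S (rsubmx x)].

Definition adjoined_directions : direction_assignment (m + n) :=
  fun x => [set row_mx (lsubmx x *m N i) (p i) | i : I].

Definition extended_directions : direction_assignment (m + n) :=
  fun x => kept_directions x :|: adjoined_directions x.

Hypothesis p_spare : forall i x, p i \notin S x.

Lemma kept_adjoined_disjoint x :
  [disjoint kept_directions x & adjoined_directions x].
Proof.
rewrite disjoints_subset; apply/subsetP=> _ /imsetP[v vS ->]; rewrite inE.
apply/imsetP=> -[i _ /eq_row_mx[_ vp]].
by rewrite vp (negPf (p_spare _ _)) in vS.
Qed.

Hypotheses (sysS : direction_system d S) (partN : square_zero_partition N).
Hypotheses (p_inj : injective p) (p_neq0 : forall i, p i != 0).
Hypothesis sum_p : \sum_i p i = 0.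

Lemma direction_system_extension :
  direction_system (d + #|I|) extended_directions.
Proof.
have [sqrN sumN] := partN.
have kept_inj : injective (fun v : 'rV['F_2]_n => row_mx (0 : 'rV['F_2]_m) v).
  by move=> v w /eq_row_mx[].
have adjoined_inj u : injective (fun i => row_mx (u *m N i) (p i)).
  by move=> i j /eq_row_mx[_ /p_inj].
split=> [x y|x|x|x].
- rewrite !inE => /orP[]/imsetP[v vS ->].
    by rewrite imset_f // linearD /= row_mxKr (direction_shift sysS).
  apply/orP; right; apply/imsetP; exists v => //.
  by rewrite linearD /= row_mxKl mulmxDl -mulmxA sqrN mulmx0 addr0.
- rewrite inE -row_mx0.
  apply/orP=> -[]/imsetP[v vS /eq_row_mx[_ v0]].
    by have /negP[] := direction_neq0 sysS (rsubmx x); rewrite v0.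
  by have /eqP[] := p_neq0 v.
- rewrite cardsU (disjoint_setI0 (kept_adjoined_disjoint x)) cards0 subn0.
  by rewrite !card_imset // (card_directions sysS).
rewrite (eq_bigl _ _ (fun y => in_setU y _ _)).
rewrite bigU ?kept_adjoined_disjoint //= !big_imset => [|i j _ _|v w _ _];
  [|exact: adjoined_inj|exact: kept_inj].
rewrite /= !sum_row_mx (sum_directions sysS) sumr_const mul0rn -mulmx_sumr.
rewrite [\sum_(i in I) N i]sumN [\sum_(i in I) p i]sum_p.
by rewrite mulmx1 add_row_mx add0r addr0 hsubmxK.
Qed.

End Extension.

Lemma square_zero_partition_0 (I : finType) :
  square_zero_partition (fun _ : I => 0 : 'M['F_2]_0).
Proof. by split=> [i|]; rewrite [LHS]flatmx0 ?[RHS]flatmx0. Qed.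

Lemma square_zero_partition_2 r : (2 < r)%N ->
  square_zero_partition
    (fun i : 'I_r =>
       [:: delta_mx 0 1; delta_mx 1 0; const_mx 1]`_i : 'M['F_2]_2).
Proof.
move=> /subnKC <-; split=> [[[|[|[|i]]] lti] /=|].
- by rewrite mul_delta_mx_cond.
- by rewrite mul_delta_mx_cond.
- apply/matrixP=> i j; rewrite !mxE big_ord_recl big_ord1 !mxE.
  exact/val_inj.
- by rewrite nth_nil mul0mx.
rewrite big_split_ord /= !big_ord_recl big_ord0 /= big1 => [|i _]; last first.
  by rewrite nth_nil.
apply/matrixP=> i j; rewrite !addr0 !mxE.
by case: i j => [[|[|//]] ?] [[|[|//]] ?]; apply/val_inj.
Qed.

End DirectionSystems.

Section CodedRows.

Variable n : nat.

Definition decode (a : nat) : 'rV['F_2]_n :=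
  (\row_(j < n) (Nat.testbit a j)%:R)%R.

Lemma decode0 : decode 0 = 0%R.
Proof. by apply/rowP=> j; rewrite !mxE Nat.bits_0. Qed.

Lemma decode_lxor a b : decode (Nat.lxor a b) = (decode a + decode b)%R.
Proof.
apply/rowP=> j; rewrite !mxE Nat.lxor_spec; apply/val_inj.
by do 2!case: Nat.testbit.
Qed.

Lemma decode_foldr_lxor s :
  decode (foldr Nat.lxor 0 s) = (\sum_(a <- s) decode a)%R.
Proof.
elim: s => [|a s IHs] /=; first by rewrite big_nil decode0.
by rewrite big_cons decode_lxor IHs.
Qed.

Lemma testbit_ltn_exp2 a i : a < 2 ^ i -> Nat.testbit a i = false.
Proof.
case: (posnP a) => [-> _|a_gt0 a_lt]; first exact: Nat.bits_0.
apply/Nat.bits_above_log2/Nat.log2_lt_pow2; first exact/ltP.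
suff -> : Nat.pow 2 i = 2 ^ i by apply/ltP.
by elim: i {a_lt} => // i /= ->; rewrite expnS.
Qed.

Lemma decode_inj : {in gtn (2 ^ n) &, injective decode}.
Proof.
move=> a b a_lt b_lt /rowP eq_ab; apply: Nat.bits_inj => i.
have [i_lt|i_ge] := ltnP i n; last first.
  have {}i_ge : 2 ^ n <= 2 ^ i by rewrite leq_exp2l.
  by rewrite !testbit_ltn_exp2 ?(leq_trans a_lt) ?(leq_trans b_lt).
have := eq_ab (Ordinal i_lt); rewrite !mxE /=.
by do 2!case: Nat.testbit.
Qed.

Definition decoded_rows : seq 'rV['F_2]_n :=
  [seq decode a | a <- iota 0 (2 ^ n)].

Definition code (x : 'rV['F_2]_n) : nat := index x decoded_rows.

Lemma size_decoded_rows : size decoded_rows = 2 ^ n.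
Proof. by rewrite size_map size_iota. Qed.

Lemma uniq_decoded_rows : uniq decoded_rows.
Proof.
rewrite map_inj_in_uniq ?iota_uniq // => a b; rewrite !mem_iota.
exact: decode_inj.
Qed.

Lemma nth_decoded_rows a : a < 2 ^ n -> nth 0%R decoded_rows a = decode a.
Proof. by move=> a_lt; rewrite (nth_map 0) ?size_iota ?nth_iota. Qed.

Lemma decodeK a : a < 2 ^ n -> code (decode a) = a.
Proof.
move=> a_lt; rewrite -nth_decoded_rows // /code.
by rewrite index_uniq ?size_decoded_rows ?uniq_decoded_rows.
Qed.

Lemma mem_decoded_rows x : x \in decoded_rows.
Proof.
have rows_sub : {subset decoded_rows <= enum 'rV['F_2]_n}.
  by move=> y _; rewrite mem_enum.
have [|_ ->] := uniq_min_size uniq_decoded_rows rows_sub; last exact: mem_enum.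
by rewrite -cardE card_rV_F2 size_decoded_rows.
Qed.

Lemma code_lt x : code x < 2 ^ n.
Proof. by rewrite -size_decoded_rows index_mem mem_decoded_rows. Qed.

Lemma codeK : cancel code decode.
Proof.
move=> x; rewrite -nth_decoded_rows ?code_lt //.
by rewrite nth_index ?mem_decoded_rows.
Qed.

Lemma codeD x y : Nat.lxor (code x) (code y) < 2 ^ n ->
  code (x + y)%R = Nat.lxor (code x) (code y).
Proof.
by move=> xy_lt; rewrite -{1}[x]codeK -{1}[y]codeK -decode_lxor decodeK.
Qed.

Lemma code0 : code 0%R = 0.
Proof. by rewrite -decode0 decodeK ?expn_gt0. Qed.

Definition distinct_nonzero_codes (s : seq nat) : bool :=
  uniq s && all (fun a => 0 < a < 2 ^ n) s.

Section CodedSets.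

Variable s : seq nat.
Hypothesis s_codes : distinct_nonzero_codes s.

Lemma mem_codes_lt a : a \in s -> a < 2 ^ n.
Proof. by have /andP[_ /allP s_lt] := s_codes; move=> /s_lt/andP[]. Qed.

Lemma code0_notin : code 0%R \notin s.
Proof.
by rewrite code0; have /andP[_ /allP s_gt0] := s_codes; apply/negP=> /s_gt0.
Qed.

Lemma mem_map_decode x : (x \in map decode s) = (code x \in s).
Proof.
apply/mapP/idP=> [[a a_s ->]|x_s]; last by exists (code x); rewrite ?codeK.
by rewrite decodeK ?mem_codes_lt.
Qed.

Lemma uniq_map_decode : uniq (map decode s).
Proof.
have /andP[s_uniq _] := s_codes; rewrite map_inj_in_uniq // => a b a_s b_s.
by apply: decode_inj; apply: mem_codes_lt.
Qed.

Lemma card_coded_set : #|[set x | code x \in s]| = size s.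
Proof.
rewrite -(size_map decode) -(card_uniqP uniq_map_decode).
by apply: eq_card => x; rewrite inE mem_map_decode.
Qed.

Lemma sum_coded_set :
  (\sum_(x in [set x | code x \in s]) x)%R = decode (foldr Nat.lxor 0 s).
Proof.
rewrite decode_foldr_lxor -(big_map decode xpredT id).
rewrite (big_uniq _ uniq_map_decode) /=.
by apply: eq_bigl => x; rewrite inE mem_map_decode.
Qed.

End CodedSets.

End CodedRows.

Section DirectionTables.

Variables (n : nat) (T : seq (seq nat)).

Definition is_direction_row (d a : nat) (s : seq nat) : bool :=
  [&& distinct_nonzero_codes n s, size s == d,
      all (fun v => v \in nth [::] T (Nat.lxor a v)) s
    & foldr Nat.lxor 0 s == a].

Definition is_direction_table (d : nat) : bool :=
  (size T == 2 ^ n) &&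
  all (fun a => is_direction_row d a (nth [::] T a)) (iota 0 (2 ^ n)).

Definition table_directions : direction_assignment n :=
  fun x => [set v | code v \in nth [::] T (code x)].

Definition spare_directions (s : seq nat) : bool :=
  [&& distinct_nonzero_codes n s, foldr Nat.lxor 0 s == 0
    & all (fun a => all (fun r => a \notin r) T) s].

Definition reach_step (s : seq nat) : seq nat :=
  undup (s ++ [seq Nat.lxor a v | a <- s, v <- nth [::] T a]).

Definition reaches_all : bool :=
  all (mem (iter (2 ^ n) reach_step [:: 0])) (iota 0 (2 ^ n)).

Section ValidTable.

Variable d : nat.
Hypothesis tabT : is_direction_table d.

Lemma table_row_lt a v : v \in nth [::] T a -> a < 2 ^ n.
Proof.
have /andP[/eqP <- _] := tabT.
by apply: contraTltn => /(nth_default [::])->.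
Qed.

Lemma direction_table_row a : a < 2 ^ n -> is_direction_row d a (nth [::] T a).
Proof.
by have /andP[_ /allP rowT] := tabT => a_lt; apply: rowT; rewrite mem_iota.
Qed.

Lemma direction_table_system : direction_system d table_directions.
Proof.
have rowT (x : 'rV_n) := direction_table_row (code_lt x).
split=> [x v|x|x|x];
  have /and4P[codes /eqP sizeT /allP shiftT /eqP sumT] := rowT x.
- by rewrite !inE => /shiftT vT; rewrite codeD ?(table_row_lt vT).
- by rewrite inE code0_notin.
- by rewrite card_coded_set.
by rewrite sum_coded_set // sumT codeK.
Qed.

Lemma direction_table_connected : reaches_all ->
  connected_graph (direction_graph table_directions).
Proof.
move=> /allP reachT; pose e := direction_graph table_directions.
have [sym_e _] := direction_graph_simple direction_table_system.
have reach_sound m a : a \in iter m reach_step [:: 0] ->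
    connect e 0%R (decode n a).
  elim: m a => [|m IHm] a /=.
    by rewrite inE => /eqP->; rewrite decode0 connect0.
  rewrite mem_undup mem_cat => /orP[/IHm//|/allpairsPdep].
  move=> [b [v [/IHm reach_b vT ->]]]; have b_lt := table_row_lt vT.
  have /and4P[codes _ _ _] := direction_table_row b_lt.
  apply: connect_trans reach_b (connect1 _).
  rewrite /e /direction_graph decode_lxor addKv_F2 inE !decodeK //.
  exact: mem_codes_lt codes _ vT.
have from0 x : connect e 0%R x.
  by rewrite -[x]codeK; apply/reach_sound/reachT; rewrite mem_iota code_lt.
by move=> x y; apply: connect_trans (from0 y); rewrite (sym_connect_sym sym_e).
Qed.

Lemma even_direction_table :
  ~~ odd d -> reaches_all -> has_regular_xor_magic n d.
Proof.
move=> d_even /direction_table_connected.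
exact: even_direction_system direction_table_system d_even.
Qed.

Lemma direction_table_extension m (s : seq nat)
    (N : 'I_(size s) -> 'M['F_2]_m) :
    square_zero_partition N -> spare_directions s ->
  direction_system (d + size s)
    (extended_directions table_directions N
       (fun i => decode n (tnth (in_tuple s) i))).
Proof.
move=> partN /and3P[codes /eqP sum0 /allP spare].
have s_mem i : tnth (in_tuple s) i \in s := mem_tnth i (in_tuple s).
have s_lt i : tnth (in_tuple s) i < 2 ^ n by apply: mem_codes_lt codes _ _.
rewrite -[X in d + X]card_ord; apply: direction_system_extension => //.
- move=> i x; rewrite inE decodeK //; apply: (allP (spare _ (s_mem i))).
  by have /andP[/eqP sizeT _] := tabT; rewrite mem_nth ?sizeT ?code_lt.
- exact: direction_table_system.
- have /andP[/(tuple_uniqP (in_tuple s)) s_inj _] := codes.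
  move=> i j /decode_inj eq_ij.
  by apply/s_inj/eq_ij; apply: s_lt.
- move=> i; apply: contraNneq (code0_notin codes) => <-.
  by rewrite decodeK.
by rewrite -(big_tnth _ _ s xpredT) -decode_foldr_lxor sum0 decode0.
Qed.

Lemma odd_direction_table_extension m (s : seq nat)
    (N : 'I_(size s) -> 'M['F_2]_m) k :
    square_zero_partition N -> spare_directions s ->
    odd_complement_degree (m + n) (d + size s) k ->
  has_regular_xor_magic (m + n) k.
Proof.
move=> partN spare.
exact: (odd_direction_system (direction_table_extension partN spare)).
Qed.

Lemma odd_direction_table_adjoin s k :
    spare_directions s -> odd_complement_degree n (d + size s) k ->
  has_regular_xor_magic n k.
Proof. exact: (odd_direction_table_extension (square_zero_partition_0 _)). Qed.

Lemma odd_direction_table_lift s k : 2 < size s ->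
    spare_directions s -> odd_complement_degree (2 + n) (d + size s) k ->
  has_regular_xor_magic (2 + n) k.
Proof.
by move=> /square_zero_partition_2; apply: odd_direction_table_extension.
Qed.

End ValidTable.

End DirectionTables.

(* The tables were found by backtracking search; [table_4_6] and [table_5_4] are
   confined to few directions so that spare ones remain for the extensions. *)
Definition table_4_4 : seq (seq nat) :=
  [:: [:: 1; 6; 10; 13]; [:: 1; 2; 5; 7]; [:: 10; 11; 13; 14];
      [:: 2; 6; 10; 13]; [:: 3; 5; 13; 15]; [:: 2; 6; 10; 11];
      [:: 6; 7; 9; 14]; [:: 2; 3; 9; 15]; [:: 3; 10; 14; 15];
      [:: 5; 10; 11; 13]; [:: 1; 6; 7; 10]; [:: 1; 3; 6; 15]; [:: 1; 5; 6; 14];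
      [:: 1; 6; 7; 13]; [:: 1; 9; 11; 13]; [:: 1; 9; 10; 13]].

Definition table_4_5 : seq (seq nat) :=
  [:: [:: 2; 3; 4; 9; 12]; [:: 4; 5; 6; 9; 15]; [:: 2; 4; 6; 13; 15];
      [:: 3; 4; 6; 13; 15]; [:: 1; 2; 4; 5; 6]; [:: 1; 4; 6; 9; 15];
      [:: 1; 2; 4; 12; 13]; [:: 1; 4; 6; 9; 13]; [:: 1; 3; 5; 6; 9];
      [:: 1; 2; 5; 6; 9]; [:: 1; 5; 12; 13; 15]; [:: 1; 2; 3; 6; 13];
      [:: 3; 5; 9; 12; 15]; [:: 2; 3; 5; 6; 15]; [:: 3; 6; 9; 13; 15];
      [:: 2; 3; 5; 6; 13]].

Definition table_4_6 : seq (seq nat) :=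
  [:: [:: 4; 5; 8; 10; 13; 14]; [:: 5; 7; 8; 10; 12; 13];
      [:: 5; 7; 8; 11; 13; 14]; [:: 4; 5; 8; 11; 12; 13];
      [:: 4; 5; 8; 9; 11; 15]; [:: 5; 7; 10; 12; 14; 15];
      [:: 5; 7; 11; 12; 13; 14]; [:: 4; 5; 8; 9; 10; 13];
      [:: 4; 6; 7; 8; 11; 14]; [:: 4; 5; 7; 8; 11; 12];
      [:: 6; 8; 10; 12; 13; 15]; [:: 5; 8; 10; 13; 14; 15];
      [:: 4; 5; 6; 8; 13; 14]; [:: 4; 9; 10; 11; 12; 13];
      [:: 5; 6; 7; 9; 13; 14]; [:: 7; 8; 10; 11; 12; 13]].

Definition table_5_4 : seq (seq nat) :=
  [:: [:: 2; 8; 21; 31]; [:: 16; 19; 21; 23]; [:: 2; 8; 23; 31];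
      [:: 20; 21; 28; 30]; [:: 1; 9; 19; 31]; [:: 1; 2; 27; 29];
      [:: 1; 14; 21; 28]; [:: 1; 2; 19; 23]; [:: 8; 14; 21; 27];
      [:: 3; 7; 19; 30]; [:: 3; 8; 20; 21]; [:: 19; 27; 29; 30];
      [:: 16; 29; 30; 31]; [:: 3; 9; 19; 20]; [:: 3; 7; 20; 30];
      [:: 23; 27; 29; 30]; [:: 2; 23; 27; 30]; [:: 2; 16; 29; 30];
      [:: 2; 19; 29; 30]; [:: 2; 21; 27; 31]; [:: 9; 19; 21; 27];
      [:: 9; 21; 23; 30]; [:: 9; 21; 23; 29]; [:: 14; 19; 20; 30];
      [:: 1; 19; 23; 29]; [:: 1; 2; 14; 20]; [:: 1; 19; 20; 28];
      [:: 1; 2; 7; 31]; [:: 2; 7; 9; 16]; [:: 9; 21; 30; 31];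
      [:: 2; 19; 20; 27]; [:: 9; 21; 28; 31]].

Definition table_5_5 : seq (seq nat) :=
  [:: [:: 1; 3; 15; 16; 29]; [:: 1; 7; 8; 16; 31]; [:: 15; 17; 20; 23; 31];
      [:: 3; 7; 15; 23; 31]; [:: 7; 8; 15; 27; 31]; [:: 13; 16; 20; 23; 27];
      [:: 1; 7; 13; 22; 27]; [:: 1; 8; 13; 20; 23]; [:: 13; 16; 23; 29; 31];
      [:: 2; 7; 8; 27; 31]; [:: 13; 16; 22; 28; 29]; [:: 2; 13; 15; 23; 28];
      [:: 3; 8; 15; 20; 28]; [:: 15; 20; 23; 28; 29]; [:: 7; 16; 17; 20; 28];
      [:: 3; 8; 15; 23; 28]; [:: 16; 22; 23; 28; 29]; [:: 5; 12; 16; 20; 28];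
      [:: 5; 7; 23; 27; 28]; [:: 7; 13; 17; 20; 28]; [:: 5; 7; 12; 13; 23];
      [:: 7; 8; 16; 23; 29]; [:: 12; 13; 20; 28; 31]; [:: 5; 12; 28; 29; 31];
      [:: 7; 12; 16; 20; 23]; [:: 2; 5; 7; 13; 20]; [:: 5; 12; 16; 20; 23];
      [:: 2; 7; 12; 13; 31]; [:: 5; 7; 22; 23; 31]; [:: 8; 12; 27; 29; 31];
      [:: 7; 13; 16; 27; 31]; [:: 5; 7; 17; 23; 27]].

Lemma table_4_4_valid : is_direction_table 4 table_4_4 4.
Proof. by vm_compute. Qed.

Lemma table_4_5_valid : is_direction_table 4 table_4_5 5.
Proof. by vm_compute. Qed.

Lemma table_4_6_valid : is_direction_table 4 table_4_6 6.
Proof. by vm_compute. Qed.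

Lemma table_5_4_valid : is_direction_table 5 table_5_4 4.
Proof. by vm_compute. Qed.

Lemma table_5_5_valid : is_direction_table 5 table_5_5 5.
Proof. by vm_compute. Qed.

Lemma regular_xor_magic_4 k :
  k \in [:: 4; 6; 8; 10] -> has_regular_xor_magic 4 k.
Proof.
rewrite !inE => /or4P[]/eqP->.
- by apply: (even_direction_table table_4_4_valid); vm_compute.
- by apply: (even_direction_table table_4_6_valid); vm_compute.
- by apply: (odd_direction_table_adjoin table_4_4_valid
    (s := [:: 4; 8; 12])); vm_compute.
- by apply: (odd_direction_table_adjoin table_4_5_valid
    (s := [::])); vm_compute.
Qed.

Lemma regular_xor_magic_5 k :
  k \in [:: 4; 16; 18; 20; 22; 24; 26] -> has_regular_xor_magic 5 k.
Proof.
rewrite !inE => /or4P[/eqP->|/eqP->|/eqP->|/or4P[]/eqP->].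
- by apply: (even_direction_table table_5_4_valid); vm_compute.
- by apply: (odd_direction_table_adjoin table_5_4_valid
    (s := [:: 4; 5; 6; 10; 11; 12; 15; 17; 22; 24; 26])); vm_compute.
- by apply: (odd_direction_table_adjoin table_5_4_valid
    (s := [:: 4; 5; 6; 10; 11; 12; 13; 17; 22])); vm_compute.
- by apply: (odd_direction_table_adjoin table_5_4_valid
    (s := [:: 4; 5; 6; 10; 15; 24; 26])); vm_compute.
- by apply: (odd_direction_table_adjoin table_5_4_valid
    (s := [:: 4; 5; 6; 10; 13])); vm_compute.
- by apply: (odd_direction_table_adjoin table_5_4_valid
    (s := [:: 5; 10; 15])); vm_compute.
- by apply: (odd_direction_table_adjoin table_5_5_valid
    (s := [::])); vm_compute.
Qed.

Lemma regular_xor_magic_6 : has_regular_xor_magic 6 54.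
Proof.
by apply: (odd_direction_table_lift table_4_6_valid
  (s := [:: 1; 2; 3])); vm_compute.
Qed.

Lemma regular_xor_magic_7 : has_regular_xor_magic 7 114.
Proof.
by apply: (odd_direction_table_lift table_5_4_valid
  (s := [:: 4; 5; 6; 10; 15; 17; 18; 24; 25])); vm_compute.
Qed.

Theorem theorem6 (n k : nat)
  (hnk : (n = 4 /\ k \in [:: 4; 6; 8; 10])
      \/ (n = 5 /\ k \in [:: 4; 16; 18; 20; 22; 24; 26])
      \/ (n = 6 /\ k = 54)
      \/ (n = 7 /\ k = 114)) :
  exists (V : finType) (e : rel V),
    closed_xor_magic n e /\ regular_graph k e.
Proof.
case: hnk => [[->]|[[->]|[[-> ->]|[-> ->]]]].
- exact: regular_xor_magic_4.
- exact: regular_xor_magic_5.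
- exact: regular_xor_magic_6.
- exact: regular_xor_magic_7.
Qed.
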